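(* Let $d \geq 2$ and $n, k \geq 0$ be integers. Then $N_d(n,k)$ equals the number of Schröder paths in $\mathcal{S}_d$ with semilength $(n-k)(d-1) + k+1$ and exactly $k$ up steps.
   Context: $N_d(n,k) = \frac{1}{n+1} \binom{n+1}{k+1} \binom{ n + (n-k)(d-2)+1}{k}$. A Schröder path is a lattice path from $(0,0)$ using up steps $U=(1,1)$, down steps $D=(1,-1)$ and horizontal steps $H=(2,0)$, never going below the $x$-axis and ending on the $x$-axis, say at $(2m,0)$; $m$ is its semilength. For an up step $U$ going from height $\ell$ to $\ell+1$, its matching down step is the first down step after it going from height $\ell+1$ to $\ell$. $\mathcal{S}_d$ is the set of nonempty Schröder paths such that (i) the total number of $H$ steps is $1+j(d-1)$ for some integer $j\ge 0$, and (ii) for every up step and its matching down step, the number of $H$ steps between them is $1+j(d-1)$ for some integer $j\ge 0$. *)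

(* Defs.v *)
From HB Require Import structures.
From mathcomp Require Import all_boot all_order all_algebra finmap.
From mathcomp Require Import boolp classical_sets functions cardinality.

Set Implicit Arguments.
Unset Strict Implicit.
Unset Printing Implicit Defensive.

Import Order.TTheory GRing.Theory Num.Theory.
Local Open Scope ring_scope.

(* For k > n the subtraction n - k is truncated to 0, but then 'C(n.+1, k.+1)
   vanishes; for k <= n and d >= 2 no subtraction truncates. *)
Definition Nd (d n k : nat) : rat :=
  n.+1%:R^-1 * 'C(n.+1, k.+1)%:R * 'C(n + (n - k) * (d - 2) + 1, k)%:R.

Inductive step := Up | Down | Horiz.

Definition step_code (s : step) : option bool :=
  match s with Up => Some true | Down => Some false | Horiz => None end.

Definition step_decode (o : option bool) : step :=
  match o with Some true => Up | Some false => Down | None => Horiz end.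

Lemma step_codeK : cancel step_code step_decode.
Proof. by case. Qed.

HB.instance Definition _ := Countable.copy step (can_type step_codeK).

Definition step_vec (s : step) : int * int :=
  match s with Up => (1, 1) | Down => (1, -1) | Horiz => (2, 0) end.

Definition endpoint (p : seq step) : int * int := \sum_(s <- p) step_vec s.

Definition height (p : seq step) (i : nat) : int := (endpoint (take i p)).2.

Definition schroder_path (p : seq step) : Prop :=
  (forall i : nat, 0 <= height p i) /\ (endpoint p).2 = 0.

Definition has_semilength (p : seq step) (m : int) : Prop :=
  endpoint p = (2 * m, 0).

(* Steps are indexed from 0, step i joining heights height p i and
   height p i.+1.  The default Horiz of nth makes [nth Horiz p i = Up] and
   [nth Horiz p i = Down] false for i out of range. *)
Definition returns_at (p : seq step) (i j : nat) : Prop :=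
  [/\ (i < j)%N, nth Horiz p j = Down,
      height p j = height p i + 1 & height p j.+1 = height p i].

Definition matching (p : seq step) (i j : nat) : Prop :=
  [/\ nth Horiz p i = Up, returns_at p i j
    & forall l : nat, returns_at p i l -> (j <= l)%N].

Definition horiz_between (p : seq step) (i j : nat) : nat :=
  count_mem Horiz (take (j - i.+1) (drop i.+1 p)).

Definition admissible (d h : nat) : Prop :=
  exists j : nat, h = (1 + j * (d - 1))%N.

Definition Sd (d : nat) : set (seq step) :=
  [set p | [/\ schroder_path p, p <> [::], admissible d (count_mem Horiz p)
             & forall i j : nat, matching p i j ->
                 admissible d (horiz_between p i j)]]%classic.

(* The semilength is computed in int, so that it is not truncated for k > n. *)
Definition counted_paths (d n k : nat) : set (seq step) :=
  [set p | [/\ Sd d p,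
               has_semilength p ((n%:Z - k%:Z) * (d%:Z - 1) + k%:Z + 1)
             & count_mem Up p = k]]%classic.

(* Main.v *)
(** Read a path from left to right, keeping a stack with, for the path itself and
    each open up step, the number of horizontal steps seen so far; a down step is
    allowed when the top entry is 1 modulo [e = d - 1] and positive, and pops it
    into the entry below.  The number of accepted completions with given numbers
    of up and horizontal steps depends on the stack only through its size and the
    total [r] of the missing residues.  It satisfies two recurrences, one for
    adding a child to the top entry and one for closing it, and these determine a
    two-term product formula.  The initial stack has size 1 and [r = 1]. *)

Require Import Defs.
From HB Require Import structures.
From mathcomp Require Import all_boot all_order all_algebra finmap.
From mathcomp Require Import boolp classical_sets functions cardinality.
From mathcomp Require Import zify ring.

Import Order.TTheory GRing.Theory Num.Theory.
Local Open Scope ring_scope.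

(** * Missing residues modulo [e] *)

(* The least [r] such that [c + r] is of the form [1 + j e]. *)
Definition need (e c : nat) : nat :=
  if c is c'.+1 then (c' * e.-1 %% e)%N else 1%N.

(** Modulo [e] the factor [e.-1] is -1, so the product in [need] represents the opposite of [c]. *)
Lemma dvdn_need (e c : nat) : (0 < e)%N -> (e %| c + need e c.+1)%N.
Proof.
case: e => // e _ /=.
by rewrite /dvdn modnDmr -{1}[c]muln1 -mulnDr add1n modnMl.
Qed.

Lemma needS_eq (e c r : nat) : (r < e)%N -> (e %| c + r)%N -> need e c.+1 = r.
Proof.
move=> ltre dvd_r; have e_gt0 : (0 < e)%N by exact: leq_ltn_trans ltre.
have /eqP : (need e c.+1 == r %[mod e])%N.
  by rewrite -(eqn_modDl c) (eqP (dvdn_need e c e_gt0)) (eqP dvd_r).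
by rewrite /= modn_mod (modn_small ltre).
Qed.

Lemma needS_pos (e c : nat) :
  (0 < e)%N -> (0 < need e c)%N -> need e c = (need e c.+1).+1.
Proof.
case: c => [|c] e_gt0 need_gt0; first by rewrite /= mul0n mod0n.
have lt_need : (need e c.+1 < e)%N by rewrite /= ltn_mod.
rewrite (@needS_eq e c.+1 (need e c.+1).-1); first by rewrite prednK.
  by rewrite (leq_ltn_trans (leq_pred _)).
by rewrite addSnnS prednK // dvdn_need.
Qed.

Lemma need_eq0 (e c : nat) :
  (0 < e)%N -> need e c = 0%N <-> exists j, c = (1 + j * e)%N.
Proof.
move=> e_gt0; split=> [|[j ->]].
  case: c => // c needc0; have := dvdn_need e c e_gt0.
  by rewrite needc0 addn0 => /dvdnP[j ->]; exists j.
by rewrite add1n (@needS_eq e _ 0) // addn0 dvdn_mull.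
Qed.

Lemma needS_eq0 (e c : nat) :
  (0 < e)%N -> need e c = 0%N -> (need e c.+1).+1 = e.
Proof.
move=> e_gt0 /need_eq0 [//|j ->].
rewrite (@needS_eq e _ e.-1) ?prednK // add1n addSnnS prednK //.
by rewrite dvdn_add ?dvdn_mull.
Qed.

(** A closed child counts for its parent like one horizontal step, its own count being 1 modulo
    [e]. *)
Lemma need_add (e a c : nat) :
  (0 < e)%N -> need e a = 0%N -> need e (a + c) = need e c.+1.
Proof.
move=> e_gt0 /need_eq0 [//|j ->]; rewrite -addnA add1n.
apply: needS_eq; first by rewrite /= ltn_mod.
by rewrite -addnA dvdn_add ?dvdn_mull ?dvdn_need.
Qed.

Arguments need : simpl never.

(** * The stack reader, its weight, and the count of accepted words *)

(* [run e (c :: s) w] reads [w] when the innermost open up step has seen [c]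
   horizontal steps since it was opened, not counting those inside nested open
   up steps, and [s] lists the enclosing ones; the last entry is the path. *)
Fixpoint run (e : nat) (s : seq nat) (w : seq step) : bool :=
  match w, s with
  | [::], [:: c] => need e c == 0%N
  | Up :: w', c :: s' => run e (0%N :: c :: s') w'
  | Down :: w', c :: c' :: s' => (need e c == 0%N) && run e ((c + c')%N :: s') w'
  | Horiz :: w', c :: s' => run e (c.+1 :: s') w'
  | _, _ => false
  end.

(* The open child of each outer level eventually contributes a number of
   horizontal steps congruent to 1, hence the successor. *)
Definition weight (e : nat) (s : seq nat) : nat :=
  if s is c :: s' then (need e c + \sum_(x <- s') need e x.+1)%N else 0%N.

Fixpoint words (L : nat) : seq (seq step) :=
  if L is L'.+1 then [seq x :: w | x <- [:: Up; Down; Horiz], w <- words L']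
  else [:: [::]].

Lemma mem_words (L : nat) (w : seq step) : (w \in words L) = (size w == L).
Proof.
elim: L w => [|L IHL] [|x w] //=.
  by rewrite !mem_cat; apply/negP => /or4P[] // /mapP[].
have inj y : injective (cons y : seq step -> _) by move=> ? ? [].
have diff y z (l : seq (seq step)) : y != z -> (y :: w \in map (cons z) l) = false.
  by move=> /negP yz; apply/negP => /mapP[v _ [/eqP]].
rewrite !mem_cat in_nil orbF eqSS -IHL.
by case: x; rewrite mem_map // !diff ?orbF.
Qed.

Lemma uniq_words (L : nat) : uniq (words L).
Proof.
elim: L => // L IHL; apply: allpairs_uniq => //.
by move=> [x v] [y w] _ _ [-> ->].
Qed.

Definition num_runs (e L : nat) (s : seq nat) (k m : nat) : nat :=
  count (fun w => [&& run e s w, count_mem Up w == k & count_mem Horiz w == m])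
    (words L).

Lemma num_runsS (e L c k m : nat) (s : seq nat) :
  num_runs e L.+1 (c :: s) k m =
  ((if k is k'.+1 then num_runs e L (0 :: c :: s) k' m else 0) +
   (if s is c' :: s' then
      if need e c == 0 then num_runs e L (c + c' :: s') k m else 0 else 0) +
   (if m is m'.+1 then num_runs e L (c.+1 :: s) k m' else 0))%N.
Proof.
rewrite /num_runs /= !count_cat addn0 addnA !count_map.
have count0 (p : pred (seq step)) : p =1 xpred0 -> count p (words L) = 0%N.
  by move=> p0; rewrite (eq_count p0) count_pred0.
congr (_ + _ + _)%N.
- case: k => [|k]; last by apply: eq_count => w /=; rewrite add1n add0n eqSS.
  by apply: count0 => w /=; rewrite andbF.
- case: s => [|c' s]; first exact: count0.
  by case: ifP => need0; [apply: eq_count|apply: count0] => w /=; rewrite need0.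
- case: m => [|m]; last by apply: eq_count => w /=; rewrite add1n add0n eqSS.
  by apply: count0 => w /=; rewrite !andbF.
Qed.

Lemma weight_cons (e c : nat) (s : seq nat) :
  weight e (c :: s) = (need e c + \sum_(x <- s) need e x.+1)%N.
Proof. by []. Qed.

Lemma weight_up (e c : nat) (s : seq nat) :
  weight e [:: 0, c & s] = (weight e (c.+1 :: s)).+1.
Proof. by rewrite !weight_cons big_cons add1n. Qed.

Lemma weight_down (e c c' : nat) (s : seq nat) : (0 < e)%N -> need e c = 0%N ->
  weight e (c + c' :: s)%N = weight e [:: c, c' & s].
Proof.
by move=> e_gt0 need0; rewrite !weight_cons big_cons need0 add0n need_add.
Qed.

Lemma weight_pos (e c : nat) (s : seq nat) : (0 < e)%N -> (0 < need e c)%N ->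
  weight e (c :: s) = (weight e (c.+1 :: s)).+1.
Proof. by move=> e_gt0 need_gt0; rewrite !weight_cons (needS_pos e c). Qed.

(** After one more horizontal step, an entry that could be closed must wait for the next number
    [1 + j e], which is [e.-1] away. *)
Lemma weight_eq0 (e c : nat) (s : seq nat) : (0 < e)%N -> need e c = 0%N ->
  (weight e (c.+1 :: s)).+1 = (weight e (c :: s) + e)%N.
Proof.
move=> e_gt0 need0; have := needS_eq0 _ _ e_gt0 need0.
by rewrite !weight_cons need0; lia.
Qed.

Lemma weight_le (e c : nat) (s : seq nat) : (0 < e)%N ->
  (weight e (c :: s) <= (weight e (c.+1 :: s)).+1)%N.
Proof.
move=> e_gt0; have [need0|need_gt0] := posnP (need e c).
  by rewrite weight_eq0 ?leq_addr.
by rewrite weight_pos.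
Qed.

(** The weight bounds below the horizontal steps still to come: each of them lowers it by at most
    one, up steps never lower it, and allowed down steps preserve it. *)
Lemma num_runs_eq0 (e L c k m : nat) (s : seq nat) : (0 < e)%N ->
  (m < weight e (c :: s))%N -> num_runs e L (c :: s) k m = 0%N.
Proof.
move=> e_gt0; elim: L c s k m => [|L IHL] c s k m lt_m.
  case: m lt_m => [|m]; last by rewrite /num_runs /= !andbF.
  case: s => // lt_m; move: lt_m; rewrite weight_cons big_nil addn0.
  by rewrite /num_runs /= lt0n => /negbTE ->.
have := weight_le e c s e_gt0 => le_w.
rewrite num_runsS.
have -> : (if k is k'.+1 then num_runs e L [:: 0, c & s] k' m else 0%N) = 0%N.
  by case: k => // k; apply: IHL; rewrite weight_up; lia.
have -> : (if m is m'.+1 then num_runs e L (c.+1 :: s) k m' else 0%N) = 0%N.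
  by case: m lt_m => // m lt_m; apply: IHL; lia.
rewrite addn0 add0n; case: s lt_m {le_w} => // c' s lt_m.
by case: eqP => // need0; apply: IHL; rewrite weight_down.
Qed.

(** * The product formula and its recurrences *)

(* With [T = z + u T / (1 - T ^ e)] the generating function of trees by leaves
   [z] and inner nodes [u], this is the coefficient of [z ^ (r + j e) u ^ k] in
   [T ^ r / (1 - T ^ e) ^ h.+1], as given by Lagrange inversion. *)
Definition run_formula (e r h k j : nat) : rat :=
  if k is k'.+1 then
    'C(r + j * e + k', k')%:R / k%:R *
    (r%:R * 'C(j + k + h, k + h)%:R + (e * h.+1)%:R * 'C(j + k + h, (k + h).+1)%:R)
  else 'C(j + h, h)%:R.

(** This is the equation for [T] multiplied by [T ^ r / (1 - T ^ e) ^ h.+1], read off at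
    [z ^ (r.+1 + j e) u ^ k]. *)
Lemma run_formula_child (e r h k j : nat) :
  run_formula e r.+1 h k j = run_formula e r h k j +
    (if k is k'.+1 then run_formula e r.+1 h.+1 k' j else 0).
Proof.
case: k => [|[|k]]; rewrite /run_formula ?addr0 //.
  by rewrite !bin0 add1n -addnA add1n -natr1; field.
(* Every term becomes a rational multiple of the product of ['C(j + a, a)] and ['C(N.+1, k)], which
   leaves an identity of rational functions. *)
set a := (k.+2 + h)%N.
have -> : (k.+1 + h.+1)%N = a by rewrite /a; lia.
have -> : (j + k.+1 + h.+1)%N = (j + a)%N by rewrite /a; lia.
have -> : (j + k.+2 + h)%N = (j + a)%N by rewrite /a; lia.
have a1 : a.+1%:R != 0 :> rat by rewrite pnatr_eq0.
have -> : 'C(j + a, a.+1)%:R = j%:R * 'C(j + a, a)%:R / a.+1%:R :> rat.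
  by apply: (mulfI a1); rewrite mulrCA divff // mulr1 -!natrM mul_bin_left addnK.
set N := (r + j * e + k)%N.
have -> : (r.+1 + j * e + k.+1)%N = N.+2 by rewrite /N; lia.
have -> : (r + j * e + k.+1)%N = N.+1 by rewrite /N; lia.
have -> : (r.+1 + j * e + k)%N = N.+1 by rewrite /N; lia.
have k1 : k.+1%:R != 0 :> rat by rewrite pnatr_eq0.
have -> : 'C(N.+2, k.+1)%:R = N.+2%:R * 'C(N.+1, k)%:R / k.+1%:R :> rat.
  by apply: (mulfI k1); rewrite mulrCA divff // mulr1 -!natrM mul_bin_diag.
have -> : 'C(N.+1, k.+1)%:R = (r + j * e).+1%:R * 'C(N.+1, k)%:R / k.+1%:R :> rat.
  apply: (mulfI k1); rewrite mulrCA divff // mulr1 -!natrM mul_bin_left.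
  by congr (_ * _)%:R; rewrite /N; lia.
move: a1; rewrite /N /a; move: 'C(_, _)%:R 'C(_, _)%:R => x y a1.
by field; rewrite -!natrD !nat1r !pnatr_eq0.
Qed.

(** This is [1 / (1 - x) = 1 + x / (1 - x)] at [x = T ^ e], multiplied by
    [T ^ r / (1 - T ^ e) ^ h.+1]. *)
Lemma run_formula_close (e r h k j : nat) :
  run_formula e r h.+1 k j.+1 =
    run_formula e r h k j.+1 + run_formula e (r + e) h.+1 k j.
Proof.
case: k => [|k]; rewrite /run_formula.
  by rewrite addSn binS addSnnS -natrD addnC.
have -> : (r + e + j * e + k = r + j.+1 * e + k)%N by lia.
have -> : (j.+1 + k.+1 + h.+1 = (j + k + h).+3)%N by lia.
have -> : (j.+1 + k.+1 + h = (j + k + h).+2)%N by lia.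
have -> : (j + k.+1 + h.+1 = (j + k + h).+2)%N by lia.
have -> : (k.+1 + h.+1 = (k + h).+2)%N by lia.
have -> : (k.+1 + h = (k + h).+1)%N by lia.
by rewrite !(binS (j + k + h).+2) !natrD; field; rewrite nat1r pnatr_eq0.
Qed.

Lemma run_formula_close0 (e r h k : nat) :
  run_formula e r h.+1 k 0 = run_formula e r h k 0.
Proof.
case: k => [|k]; rewrite /run_formula !add0n !binn //.
by have small i : 'C(i, i.+1) = 0%N by [rewrite bin_small]; rewrite !small !mulr0.
Qed.

(** The same geometric identity at [r = h = 0], where the constant 1 contributes nothing to a
    positive power of [z]. *)
Lemma run_formula_root (e k j : nat) :
  run_formula e 0 0 k j.+1 = run_formula e e 0 k j.
Proof.
case: k => [|k]; rewrite /run_formula; first by rewrite !bin0.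
have -> : (e + j * e + k = 0 + j.+1 * e + k)%N by lia.
rewrite !addn0 (addSn j k.+1) (binS (j + k.+1) k.+1) natrD.
by field; rewrite nat1r pnatr_eq0.
Qed.

Lemma run_formula_root0 (e k : nat) : run_formula e 0 0 k.+1 0 = 0.
Proof.
by rewrite /run_formula add0n (@bin_small _ (k.+1 + 0).+1) // mul0r add0r !mulr0.
Qed.

(** * The count of accepted words equals the formula *)

Lemma num_runsE (e L c k m j : nat) (s : seq nat) : (0 < e)%N ->
  L = (m + k.*2 + size s)%N -> m = (weight e (c :: s) + j * e)%N ->
  (num_runs e L (c :: s) k m)%:R = run_formula e (weight e (c :: s)) (size s) k j.
Proof.
move=> e_gt0; elim: L c s k m j => [|L IHL] c s k m j defL defm.
  have [m0 k0 s0] : [/\ m = 0, k = 0 & size s = 0]%N by split; lia.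
  move: s0 defm => /size0nil ->; rewrite m0 k0 weight_cons big_nil addn0.
  move=> /esym/eqP; rewrite addn_eq0 muln_eq0 (gtn_eqF e_gt0) orbF.
  by move=> /andP[/eqP need0 /eqP ->]; rewrite /num_runs /= need0.
(* Up and horizontal steps lead to weights [r.+1] and [r]; the latter also lowers [m] by one, so the
   same [i] serves both. *)
have child r i : weight e (c.+1 :: s) = r -> m = (r.+1 + i * e)%N ->
    ((if k is k'.+1 then num_runs e L [:: 0, c & s] k' m else 0) +
     (if m is m'.+1 then num_runs e L (c.+1 :: s) k m' else 0))%:R
    = run_formula e r.+1 (size s) k i.
  move=> defr defm'; rewrite run_formula_child addrC natrD; congr (_ + _).
    case: k defL => // k defL.
    rewrite -defr -weight_up; apply: (IHL _ [:: c & s]).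
      by move: defL => /=; lia.
    by rewrite weight_up defr.
  rewrite -defr; case: m defL defm defm' => [|m] defL defm defm'; first lia.
  by apply: IHL; lia.
rewrite num_runsS addnAC natrD.
have := leq0n (need e c).
rewrite leq_eqVlt => /predU1P[/esym need0|need_gt0]; last first.
  have -> : (if s is c' :: s' then
     if need e c == 0 then num_runs e L (c + c' :: s')%N k m else 0 else 0)%N = 0%N.
    by case: s {defL defm child} => // c' s; rewrite gtn_eqF.
  rewrite addr0 weight_pos //; apply: child => //.
  by rewrite -weight_pos.
have defW := weight_eq0 e c s e_gt0 need0.
have close c' s' : s = c' :: s' ->
    (num_runs e L (c + c' :: s')%N k m)%:R
    = run_formula e (weight e (c :: s)) (size s') k j.
  move=> def_s; rewrite def_s in defL defm *.
  rewrite -weight_down //; apply: IHL; last by rewrite weight_down.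
  by move: defL => /=; lia.
(* With [j = 0] the horizontal steps just cover the weight; a first step other than down would
   require [e] more of them. *)
case: j defm child close => [|j] defm child close.
  have -> : ((if k is k'.+1 then num_runs e L [:: 0, c & s] k' m else 0) +
     (if m is m'.+1 then num_runs e L (c.+1 :: s) k m' else 0))%N = 0%N.
    rewrite mul0n addn0 in defm; apply/eqP; rewrite addn_eq0; apply/andP; split.
      case: k {defL child close} => // k.
      by rewrite num_runs_eq0 // weight_up; lia.
    case: m {defL child close} defm => // m defm.
    by rewrite num_runs_eq0 //; lia.
  rewrite add0r need0; case: s defL defm close {child defW} => [|c' s] defL defm close.
    rewrite weight_cons big_nil addn0 need0 in defm *.
    by case: k defL {close} => [|k] /= defL; [lia | exact/esym/run_formula_root0].
  by rewrite eqxx (close c' s) // run_formula_close0.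
(* The weight in [child] exceeds the current one by [e], which uses up one unit of [j]. *)
rewrite (child _ j erefl); last by rewrite defm defW; lia.
rewrite defW need0 eqxx.
case: s {defL defm child defW} close => [|c' s] close.
  by rewrite addr0 weight_cons big_nil addn0 need0 add0n /= run_formula_root.
by rewrite (close c' s) //= addrC -run_formula_close.
Qed.

(** The initial stack gives [r = 1] and [h = 0]; the number [1 + (n - k) * d.-1] of horizontal steps
    gives [j = n - k]. *)
Lemma run_formula_Nd (d n k : nat) : (2 <= d)%N -> (k <= n)%N ->
  run_formula d.-1 1 0 k (n - k) = Nd d n k.
Proof.
case: d => [|[|e]] // _ le_kn.
rewrite -(subnK le_kn) addnK; move: (n - k)%N => j {n le_kn}.
rewrite /Nd addnK !subSS subn0 /=; case: k => [|k].
  by rewrite /run_formula !bin0 !bin1 mulVf ?pnatr_eq0.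
rewrite /run_formula !addn0.
have -> : (j + k.+1 + j * e + 1 = (1 + j * e.+1 + k).+1)%N by lia.
have nz i : i.+1%:R != 0 :> rat by rewrite pnatr_eq0.
have -> : 'C((1 + j * e.+1 + k).+1, k.+1)%:R
    = (1 + j * e.+1 + k).+1%:R * 'C(1 + j * e.+1 + k, k)%:R / k.+1%:R :> rat.
  by apply: (mulfI (nz k)); rewrite mulrCA divff // mulr1 -!natrM mul_bin_diag.
have -> : 'C((j + k.+1).+1, k.+2)%:R
    = (j + k.+1).+1%:R * 'C(j + k.+1, k.+1)%:R / k.+2%:R :> rat.
  by apply: (mulfI (nz k.+1)); rewrite mulrCA divff // mulr1 -!natrM mul_bin_diag.
have -> : 'C(j + k.+1, k.+2)%:R = j%:R * 'C(j + k.+1, k.+1)%:R / k.+2%:R :> rat.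
  by apply: (mulfI (nz k.+1)); rewrite mulrCA divff // mulr1 -!natrM mul_bin_left addnK.
by field; rewrite !(nat1r, =^~ natrD) !pnatr_eq0.
Qed.

(** * Heights and matching down steps *)

Lemma height0 (p : seq step) : height p 0 = 0.
Proof. by rewrite /height take0 /endpoint big_nil. Qed.

Lemma heightS (x : step) (p : seq step) (i : nat) :
  height (x :: p) i.+1 = (step_vec x).2 + height p i.
Proof. by rewrite /height /endpoint /= big_cons. Qed.

Lemma height_oversize (p : seq step) (i : nat) :
  (size p <= i)%N -> height p i = (endpoint p).2.
Proof. by move=> le_i; rewrite /height take_oversize. Qed.

Lemma height_add (p : seq step) (i j : nat) :
  height p (i + j) = height p i + height (drop i p) j.
Proof. by rewrite /height takeD /endpoint big_cat. Qed.

Lemma height_nth (p : seq step) (i : nat) : (i < size p)%N ->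
  height p i.+1 = height p i + (step_vec (nth Horiz p i)).2.
Proof.
by move=> lt_i; rewrite /height (take_nth Horiz) // /endpoint -cats1 big_cat big_seq1.
Qed.

(** Heights are relative to the start of a suffix [p]. The first such step closes the open up step
    that has [t] other open ones inside it. *)
Definition descends (p : seq step) (t j : nat) : Prop :=
  nth Horiz p j = Down /\ height p j = - t%:Z.

Definition first_descent (p : seq step) (t j : nat) : Prop :=
  descends p t j /\ forall l, descends p t l -> (j <= l)%N.

(** Measuring heights from the end of the up step turns its matching down step into the first
    descent from level 0. *)
Lemma matching_first_descent (p : seq step) (i j : nat) :
  matching p i j <->
  [/\ (i < j)%N, nth Horiz p i = Up & first_descent (drop i.+1 p) 0 (j - i.+1)].
Proof.
have nth_size x l : nth Horiz p l = x -> x <> Horiz -> (l < size p)%N.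
  by move=> defx xH; rewrite ltnNge; apply/negP => /(nth_default Horiz); rewrite defx.
have descE l : nth Horiz p i = Up -> (i < l)%N ->
    returns_at p i l <-> descends (drop i.+1 p) 0 (l - i.+1).
  move=> upi lt_il; rewrite /returns_at /descends nth_drop subnKC //.
  have lt_i : (i < size p)%N by apply: nth_size upi _.
  have hl : height p l = height p i + 1 + height (drop i.+1 p) (l - i.+1).
    by rewrite -{1}(subnKC lt_il) height_add height_nth // upi.
  split=> [[_ downl eq_l _]|[downl eq_l]]; first by split=> //; lia.
  have lt_l : (l < size p)%N by apply: nth_size downl _.
  by split=> //; [|rewrite height_nth // downl /=]; lia.
split=> [[upi retj minj]|[lt_ij upi [descj minj]]].
  have [lt_ij _ _ _] := retj; split=> //; split; first exact/descE.
  move=> l descl; rewrite leq_subLR; apply: minj; apply/descE => //; first lia.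
  by rewrite addKn.
split=> //; first exact/descE.
move=> l retl; have [lt_il _ _ _] := retl.
by have /minj : descends (drop i.+1 p) 0 (l - i.+1) by [exact/descE]; lia.
Qed.

(** Dropping the first step shifts the origin of heights, hence [t']; the second hypothesis prevents
    that step from being the descent itself. *)
Lemma first_descent_cons (x : step) (p : seq step) (t t' j : nat) :
  - t%:Z = (step_vec x).2 - t'%:Z -> (x = Down -> t <> 0%N) ->
  first_descent (x :: p) t j <->
  exists2 j', j = j'.+1 & first_descent p t' j'.
Proof.
move=> deft xt.
have descS l : descends (x :: p) t l.+1 <-> descends p t' l.
  by rewrite /descends heightS /=; split=> -[-> ?]; split=> //; lia.
have desc0 : ~ descends (x :: p) t 0.
  by case=> /= xD; rewrite height0 => t0; apply: (xt xD); lia.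
split=> [[descj minj]|[l -> [descl minl]]].
  case: j descj minj => [//|j] /descS descj minj; exists j => //; split=> //.
  by move=> l /descS/minj.
split; first exact/descS.
by case=> [/desc0|l' /descS/minl].
Qed.

Lemma first_descent_down0 (p : seq step) (j : nat) :
  first_descent (Down :: p) 0 j <-> j = 0%N.
Proof.
have desc0 : descends (Down :: p) 0 0 by rewrite /descends height0.
split=> [[_ /(_ _ desc0)]|->]; last by split.
by rewrite leqn0 => /eqP.
Qed.

(** * What the stack reader accepts, in terms of heights *)

(* Entry [t] of the stack is popped at the first descent of the remaining path
   [p] from relative height [- t], which is where [valid_open] constrains it. *)
Record valid_suffix (e : nat) (s : seq nat) (p : seq step) : Prop := ValidSuffix {
  valid_height : forall i, 0 <= (size s).-1%:Z + height p i;
  valid_end : (size s).-1%:Z + (endpoint p).2 = 0;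
  valid_open : forall t j, (t < (size s).-1)%N -> first_descent p t j ->
    need e (sumn (take t.+1 s) + count_mem Horiz (take j p)) = 0%N;
  valid_total : need e (sumn s + count_mem Horiz p) = 0%N;
  valid_inner : forall i j, nth Horiz p i = Up ->
    first_descent (drop i.+1 p) 0 j ->
    need e (count_mem Horiz (take j (drop i.+1 p))) = 0%N }.

Lemma valid_suffix_horiz (e c : nat) (s : seq nat) (p : seq step) :
  valid_suffix e (c :: s) (Horiz :: p) <-> valid_suffix e (c.+1 :: s) p.
Proof.
have fdE t j : first_descent (Horiz :: p) t j <->
    exists2 l, j = l.+1 & first_descent p t l.
  by apply: first_descent_cons => //=; lia.
split=> -[vh ve vo vt vi]; split=> //=.
- by move=> i; have := vh i.+1; rewrite heightS add0r.
- by move: ve; rewrite /endpoint big_cons /= add0r.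
- move=> t j lt_t fd; rewrite addSn addSnnS.
  by apply: (vo t j.+1) => //; apply/fdE; exists j.
- by rewrite addSn addSnnS.
- by move=> i j; apply: (vi i.+1).
- by case=> [|i]; [rewrite height0; lia | rewrite heightS add0r].
- by rewrite /endpoint big_cons /= add0r.
- by move=> t j lt_t /fdE[l -> fd]; rewrite /= add1n -addSnnS -addSn; exact: vo.
- by rewrite add1n -addSnnS -addSn.
- by case=> [//|i] j; apply: vi.
Qed.

(** The [valid_inner] condition of the up step read becomes the [valid_open] condition of the new
    top entry. *)
Lemma valid_suffix_up (e c : nat) (s : seq nat) (p : seq step) :
  valid_suffix e (c :: s) (Up :: p) <-> valid_suffix e [:: 0%N, c & s] p.
Proof.
have fdE t j : first_descent (Up :: p) t j <->
    exists2 l, j = l.+1 & first_descent p t.+1 l.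
  by apply: first_descent_cons => //=; lia.
split=> -[vh ve vo vt vi]; split=> //=.
- by move=> i; have := vh i.+1; rewrite heightS /=; lia.
- by move: ve; rewrite /endpoint big_cons /=; lia.
- case=> [|t] j lt_t fd.
    by have := vi 0%N j erefl; rewrite /= drop0; exact.
  by apply: (vo t j.+1) => //; apply/fdE; exists j.
- by move=> i j; apply: (vi i.+1).
- case=> [|i]; first by rewrite height0; lia.
  by rewrite heightS; have := vh i => /=; lia.
- by move: ve; rewrite /endpoint big_cons /=; lia.
- by move=> t j lt_t /fdE[l -> fd]; exact: (vo t.+1).
- case=> [|i] j; last exact: vi.
  by rewrite drop0 => _; apply: (vo 0%N).
Qed.

(** The down step is the first descent from level 0, whence the condition on [c]; merging [c] into
    [c'] keeps the partial sums used by deeper entries. *)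
Lemma valid_suffix_down (e c c' : nat) (s : seq nat) (p : seq step) :
  valid_suffix e [:: c, c' & s] (Down :: p) <->
  need e c = 0%N /\ valid_suffix e (c + c' :: s)%N p.
Proof.
have fdE t j : first_descent (Down :: p) t.+1 j <->
    exists2 l, j = l.+1 & first_descent p t l.
  by apply: first_descent_cons => //=; lia.
split=> [[vh ve vo vt vi]|[need0 [vh ve vo vt vi]]].
  split; last split=> //=.
  - have /(vo 0%N 0%N isT) := (first_descent_down0 p 0).2 erefl.
    by rewrite /= !addn0.
  - by move=> i; have := vh i.+1; rewrite heightS /=; lia.
  - by move: ve; rewrite /endpoint big_cons /=; lia.
  - move=> t j lt_t fd; rewrite -(addnA c c').
    by apply: (vo t.+1 j.+1) => //; apply/fdE; exists j.
  - by rewrite -(addnA c c').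
  - by move=> i j; apply: (vi i.+1).
split=> //=.
- case=> [|i]; first by rewrite height0; lia.
  by rewrite heightS; have := vh i => /=; lia.
- by move: ve; rewrite /endpoint big_cons /=; lia.
- case=> [|t] j lt_t; first by move=> /first_descent_down0 ->; rewrite /= !addn0.
  by case/fdE=> l -> fd; rewrite /= (addnA c c'); exact: (vo t).
- by rewrite (addnA c c').
- by case=> [//|i] j; apply: vi.
Qed.

Lemma runP (e c : nat) (s : seq nat) (p : seq step) :
  run e (c :: s) p <-> valid_suffix e (c :: s) p.
Proof.
elim: p c s => [|x p IHp] c s.
  split.
    case: s => //= /eqP need0; split=> //=.
    - by move=> i; rewrite height_oversize // /endpoint big_nil.
    - by rewrite /endpoint big_nil.
    - by rewrite !addn0.
    - by move=> i j; rewrite nth_nil.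
  case=> _ ve _ vt _; case: s ve vt => [|c' s] /=.
    by rewrite !addn0 => _ ->.
  by rewrite /endpoint big_nil.
case: x => /=.
- by rewrite IHp valid_suffix_up.
- case: s => [|c' s].
    (* A down step with no open up step would take the path below the axis. *)
    split=> // -[vh _ _ _ _]; have := vh 1%N.
    by rewrite heightS height0.
  rewrite valid_suffix_down -IHp; split=> [/andP[/eqP]|[-> ->]] //.
- by rewrite IHp valid_suffix_horiz.
Qed.

(** * Step counts and translation of the path conditions *)

Lemma endpointE (p : seq step) :
  endpoint p =
  ((count_mem Up p + count_mem Down p + (count_mem Horiz p).*2)%:Z,
   (count_mem Up p)%:Z - (count_mem Down p)%:Z).
Proof.
elim: p => [|x p IHp]; first by rewrite /endpoint big_nil.
rewrite /endpoint big_cons -/(endpoint p) IHp.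
by case: x; apply: injective_projections => /=; lia.
Qed.

Lemma has_semilengthP (p : seq step) (m : int) :
  has_semilength p m <->
  count_mem Up p = count_mem Down p /\
  (count_mem Up p + count_mem Horiz p)%N%:Z = m.
Proof.
rewrite /has_semilength endpointE; split=> [end_p|[eq_ud <-]].
  have e1 : (count_mem Up p + count_mem Down p + (count_mem Horiz p).*2)%N%:Z
      = 2 * m := congr1 fst end_p.
  have e2 : (count_mem Up p)%:Z - (count_mem Down p)%:Z = 0 := congr1 snd end_p.
  by split; lia.
by congr (_, _); lia.
Qed.

Lemma schroder_count (p : seq step) :
  schroder_path p -> count_mem Down p = count_mem Up p.
Proof.
case=> _; rewrite endpointE => end_p.
have : (count_mem Up p)%:Z - (count_mem Down p)%:Z = 0 := end_p.
lia.
Qed.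

Lemma size_count_steps (p : seq step) :
  size p = (count_mem Up p + count_mem Down p + count_mem Horiz p)%N.
Proof. by elim: p => [|[] p /= ->] //; lia. Qed.

(** On the initial stack no up step is open, so [valid_open] is vacuous; the other fields express
    the height, total and matching conditions. *)
Lemma Sd_run (d : nat) (p : seq step) : (2 <= d)%N ->
  Sd d p <-> run d.-1 [:: 0%N] p.
Proof.
move=> hd; have e_gt0 : (0 < d.-1)%N by lia.
have admE h : admissible d h <-> need d.-1 h = 0%N.
  by rewrite need_eq0 // /admissible subn1.
rewrite runP; split.
  case=> -[hp ep] _ adm_p adm_m; split=> //=.
  - by move=> i; rewrite add0r.
  - by rewrite add0r.
  - by rewrite add0n; exact/admE.
  - move=> i j upi fd; apply/admE.
    have <- : horiz_between p i (i.+1 + j) = count_mem Horiz (take j (drop i.+1 p)).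
      by rewrite /horiz_between addKn.
    apply: adm_m; apply/matching_first_descent; split=> //; first lia.
    by rewrite addKn.
case=> /= vh ve _ vt vi; split.
- by split=> [i|]; [have := vh i; rewrite add0r | rewrite -ve add0r].
- by move=> p0; move: vt; rewrite p0.
- exact/admE.
- by move=> i j /matching_first_descent[_ upi fd]; apply/admE/vi.
Qed.

Lemma counted_pathsP (d n k : nat) (p : seq step) : (2 <= d)%N -> (k <= n)%N ->
  counted_paths d n k p <->
  [/\ run d.-1 [:: 0%N] p, count_mem Up p = k
    & count_mem Horiz p = (1 + (n - k) * d.-1)%N].
Proof.
move=> hd le_kn.
have semiE : (n%:Z - k%:Z) * (d%:Z - 1) + k%:Z + 1 =
    (1 + (n - k) * d.-1 + k)%N%:Z.
  by rewrite !PoszD PoszM -subzn // predn_int; lia.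
move: (1 + _)%N semiE => m semiE.
split=> [[/(Sd_run d p hd) runp /has_semilengthP]|[runp upk horp]].
  by rewrite semiE => -[eq_ud semi_p] upk; split=> //; lia.
have sd_p := (Sd_run d p hd).2 runp; split=> //; apply/has_semilengthP.
have [/schroder_count -> _ _ _] := sd_p.
by rewrite upk horp semiE addnC.
Qed.

Lemma counted_paths_empty (d n k : nat) (p : seq step) : (2 <= d)%N -> (n < k)%N ->
  ~ counted_paths d n k p.
Proof.
move=> hd lt_nk [[_ _ [j horp] _]].
rewrite has_semilengthP horp => -[eq_ud semi_p] upk.
(* The semilength would force [1 - (k - n) * (d - 1)] horizontal steps, against [1 + j * (d - 1)];
   the witnesses avoid truncated subtraction. *)
have [x defk] : exists x, k = (n + x.+1)%N by exists (k - n.+1)%N; lia.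
have [e defd] : exists e, d = e.+2 by exists (d - 2)%N; lia.
subst d k; nia.
Qed.

(** * Cardinality of the set of counted paths *)

Local Open Scope fset_scope.

Theorem theorem3p1 (d n k : nat) (hd : (2 <= d)%N) :
  finite_set (counted_paths d n k) /\
  Nd d n k = #|` fset_set (counted_paths d n k)|%:R.
Proof.
have e_gt0 : (0 < d.-1)%N by lia.
case: (leqP k n) => [le_kn|lt_nk]; last first.
  have -> : counted_paths d n k = set0%classic.
    by rewrite -subset0 => p /counted_paths_empty; apply.
  split; first exact: finite_set0.
  by rewrite fset_set0 cardfs0 /Nd bin_small // mulr0 mul0r.
(* A counted path has [m] horizontal, [k] up and [k] down steps, hence length [L]. *)
pose m := (1 + (n - k) * d.-1)%N; pose L := (m + k.*2)%N.
pose good p := [&& run d.-1 [:: 0%N] p, count_mem Up p == k & count_mem Horiz p == m].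
pose l := [seq p <- words L | good p].
have -> : counted_paths d n k = [set` [fset p in l]]%classic.
  apply/seteqP; split=> p /=; rewrite !inE mem_filter mem_words.
    move=> cp; have [runp upp horp] := (counted_pathsP d n k p hd le_kn).1 cp.
    rewrite /good runp upp horp !eqxx size_count_steps horp /=.
    have [[/schroder_count -> _ _ _] _ _] := cp; rewrite upp.
    by apply/eqP; rewrite /L /m; lia.
  by case/andP => /and3P[runp /eqP upp /eqP horp] _; apply/counted_pathsP.
split; first exact: finite_fset.
rewrite set_fsetK card_fseq undup_id ?filter_uniq ?uniq_words // size_filter.
rewrite -run_formula_Nd //.
have w0 : weight d.-1 [:: 0%N] = 1%N by rewrite weight_cons big_nil.
rewrite -{1}w0 -(@num_runsE d.-1 L 0 k m (n - k) [::]) ?w0 //=.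
by rewrite addn0.
Qed.
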